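(* Let $P=(X,\prec)$ be a poset on $|X|\ge 2$ elements and fix a nonempty subset $A\subseteq X$. Let $f$ be a uniformly random linear extension of $P$ and let $f_{\min}(A):=\min\{f(a):a\in A\}$. Then $$\mathbb{P}[f_{\min}(A)>1]^2\ \ge\ \mathbb{P}[f_{\min}(A)>2]$$ and $$\mathbb{P}[f_{\min}(A)=1]\cdot\mathbb{P}[f_{\min}(A)>1]\ \le\ \mathbb{P}[f_{\min}(A)=2].$$
   Context: A linear extension of a poset $P=(X,\prec)$ with $|X|=n$ is a bijection $f:X\to\{1,\dots,n\}$ such that $u\prec v$ implies $f(u)<f(v)$. Probabilities are with respect to the uniform distribution on the set of linear extensions of $P$. *)

(* Defs.v *)
From mathcomp Require Import all_boot all_order all_algebra.

Set Implicit Arguments.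
Unset Strict Implicit.
Unset Printing Implicit Defensive.

Import Order.TTheory GRing.Theory Num.Theory.

Section LinearExtensions.

Variables (d : Order.disp_t) (X : finPOrderType d).

(* {1, ..., n} is encoded as 'I_n through i |-> i.+1. *)
Definition bijectiveb (f : {ffun X -> 'I_#|X|}) : bool :=
  injectiveb f && [forall i, exists x, f x == i].

Definition lin_ext : {set {ffun X -> 'I_#|X|}} :=
  [set f | bijectiveb f &&
           [forall u, forall v, (u < v)%O ==> (f u < f v)%N]].

Definition pos (f : {ffun X -> 'I_#|X|}) (x : X) : nat := (f x).+1.

(* The default value #|X| is an upper bound of pos f, so for A nonempty this
   is the minimum of pos f over A. *)
Definition fmin (A : {set X}) (f : {ffun X -> 'I_#|X|}) : nat :=
  \big[minn/#|X|]_(a in A) pos f a.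

Definition Pr (E : pred {ffun X -> 'I_#|X|}) : rat :=
  (#|[set f in lin_ext | E f]|%:R / #|lin_ext|%:R)%R.

End LinearExtensions.

(* Main.v *)
Require Import Defs.
From mathcomp Require Import all_boot all_order all_algebra.
From mathcomp Require Import ring lra.

Set Implicit Arguments.
Unset Strict Implicit.
Unset Printing Implicit Defensive.

Import Order.TTheory GRing.Theory Num.Theory.

(* Both inequalities say N_2 N_0 <= N_1 ^ 2, where N_k is the number of linear
   extensions whose first k letters avoid A.  Counting linear extensions by
   their first two letters x, y defines a form M on functions on the minimal
   elements, which becomes symmetric when y is credited to x if x < y, as y then
   could not have come first.  With v the indicator of the complement of A,
   N_0 = M(1, 1), N_1 = M(v, 1) and N_2 <= M(v, v), so it suffices that
   M(v, v) M(1, 1) <= M(v, 1) ^ 2 for all v.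

   This is proved by induction on the poset, in the style of the combinatorial
   atlases of Chan and Pak.  Removing a minimal element x transports v to a
   function v_x on the minimal elements of P - x, with (M v)_x = M_x(v_x, 1) and
   (M 1)_x = M_x(1, 1).  The induction hypothesis gives
     sum_x (M v)_x ^ 2 / (M 1)_x >= sum_x M_x(v_x, v_x) >= M(v, v),
   where the last step compares the possible orders of the first three letters.
   A spectral argument turns this into the inequality for M. *)

Local Open Scope ring_scope.

Lemma setD1C (T : finType) (S : {set T}) x y : S :\ x :\ y = S :\ y :\ x.
Proof. by apply/setP => z; rewrite !inE andbCA. Qed.

Lemma map_index_uniq (T : eqType) (s : seq T) :
  uniq s -> [seq index x s | x <- s] = iota 0 (size s).
Proof.
move=> s_uniq; apply: (@eq_from_nth _ 0); rewrite size_map ?size_iota //.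
move=> i si; case: s s_uniq si => // x s s_uniq si.
by rewrite (nth_map x) // index_uniq // nth_iota.
Qed.

Lemma sum3_symmetrize (V : nmodType) (T : finType) (F : T -> T -> T -> V) :
  (\sum_x \sum_y \sum_z F x y z) *+ 6 = \sum_x \sum_y \sum_z
    (F x y z + F x z y + F y x z + F y z x + F z x y + F z y x).
Proof.
have swap12 (G : T -> T -> T -> V) :
    \sum_x \sum_y \sum_z G y x z = \sum_x \sum_y \sum_z G x y z.
  exact: exchange_big.
have swap23 (G : T -> T -> T -> V) :
    \sum_x \sum_y \sum_z G x z y = \sum_x \sum_y \sum_z G x y z.
  by apply: eq_bigr => x _; apply: exchange_big.
under [RHS]eq_bigr do under eq_bigr do rewrite !big_split /=.
under [RHS]eq_bigr do rewrite !big_split /=.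
rewrite !big_split /= (swap12 (fun x y z => F z x y)).
rewrite (swap12 (fun x y z => F x z y)) (swap23 (fun x y z => F y x z)).
by rewrite (swap12 F) (swap23 F) !mulrSr mulr0n add0r.
Qed.

Lemma fredholm_alternative (F : fieldType) (T U : finType)
    (L : T -> U -> F) (u : T -> F) :
    (forall c, (forall y, \sum_x c x * L x y = 0) -> \sum_x c x * u x = 0) ->
  exists w, forall x, \sum_y L x y * w y = u x.
Proof.
move=> uker.
have sum_enum_val (V : finType) (G : V -> F) :
    \sum_x G x = \sum_(i < #|V|) G (enum_val i).
  by rewrite -big_enum_val; apply: eq_bigl.
pose A := \matrix_(j < #|U|, i < #|T|) L (enum_val i) (enum_val j).
pose b := \row_(i < #|T|) u (enum_val i).
have /submxP[w bE] : (b <= A)%MS.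
  rewrite submxE; apply/eqP/matrixP => i k; rewrite !mxE.
  rewrite -[RHS](uker (fun x => cokermx A (enum_rank x) k)) => [|y].
    rewrite [RHS]sum_enum_val.
    by apply: eq_bigr => j _; rewrite mxE enum_valK mulrC.
  have /matrixP/(_ (enum_rank y) k) := mulmx_coker A.
  rewrite [LHS]mxE [RHS]mxE => coker_y; rewrite -[RHS]coker_y sum_enum_val.
  by apply: eq_bigr => j _; rewrite [A _ _]mxE enum_valK enum_rankK mulrC.
exists (fun y => w 0 (enum_rank y)) => x.
have /matrixP/(_ 0 (enum_rank x)) := bE; rewrite !mxE enum_rankK => ->.
rewrite sum_enum_val.
by apply: eq_bigr => j _; rewrite mxE enum_valK enum_rankK mulrC.
Qed.

Section SymmetricForms.

Variables (R : realFieldType) (T : finType) (N : T -> T -> R).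
Implicit Types u v w c : T -> R.

Definition degree x : R := \sum_y N x y.

Definition adjacency v x : R := \sum_y N x y * v y.

Definition bform v w : R := \sum_x v x * adjacency w x.

Definition laplacian v x : R := degree x * v x - adjacency v x.

Definition hyperbolic : Prop := forall v,
  bform v v * bform (fun=> 1) (fun=> 1) <= bform v (fun=> 1) ^+ 2.

Lemma bform_linearl a b u v w :
  bform (fun x => a * u x + b * v x) w = a * bform u w + b * bform v w.
Proof.
by rewrite /bform !mulr_sumr -big_split; apply: eq_bigr => x _ /=; ring.
Qed.

Lemma adjacency1 x : adjacency (fun=> 1) x = degree x.
Proof. by apply: eq_bigr => y _; rewrite mulr1. Qed.

Lemma bform1r v : bform v (fun=> 1) = \sum_x v x * degree x.
Proof. by apply: eq_bigr => x _; rewrite adjacency1. Qed.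

Hypothesis N_sym : forall x y, N x y = N y x.

Lemma bform_sym v w : bform v w = bform w v.
Proof.
rewrite /bform /adjacency; under eq_bigr do rewrite mulr_sumr.
rewrite exchange_big /=; apply: eq_bigr => x _; rewrite mulr_sumr.
by apply: eq_bigr => y _; rewrite N_sym; ring.
Qed.

Lemma bform_linearr a b u v w :
  bform w (fun x => a * u x + b * v x) = a * bform w u + b * bform w v.
Proof. by rewrite bform_sym bform_linearl !(bform_sym w). Qed.

Lemma laplacian_energy v :
  (\sum_x v x * laplacian v x) *+ 2 = \sum_x \sum_y N x y * (v x - v y) ^+ 2.
Proof.
pose G x y := N x y * v x * (v x - v y).
have energyE : \sum_x v x * laplacian v x = \sum_x \sum_y G x y.
  apply: eq_bigr => x _.
  rewrite /laplacian /degree /adjacency mulr_suml -sumrB mulr_sumr.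
  by apply: eq_bigr => y _; rewrite /G; ring.
rewrite energyE mulr2n {2}exchange_big -big_split; apply: eq_bigr => x _ /=.
by rewrite -big_split; apply: eq_bigr => y _; rewrite /G (N_sym y x) /=; ring.
Qed.

Hypothesis N_ge0 : forall x y, 0 <= N x y.

Lemma degree_ge0 x : 0 <= degree x.
Proof. exact: sumr_ge0. Qed.

Lemma weight_degree0 x y : degree x = 0 -> N x y = 0.
Proof.
by move=> /eqP; rewrite psumr_eq0 // => /allP/(_ y (mem_index_enum y))/eqP.
Qed.

Lemma laplacian_energy_ge0 v : 0 <= \sum_x v x * laplacian v x.
Proof.
rewrite -(pmulrn_lge0 _ (ltn0Sn 1)) laplacian_energy.
by do 2!(apply: sumr_ge0 => ? _); rewrite mulr_ge0 ?sqr_ge0.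
Qed.

Lemma bform_le_degree v : bform v v <= \sum_x degree x * v x ^+ 2.
Proof.
have := laplacian_energy_ge0 v; rewrite /laplacian.
by under eq_bigr do rewrite mulrBr mulrCA -expr2; rewrite sumrB subr_ge0.
Qed.

(* Where the degree vanishes both sides are 0. *)
Lemma degree_mul_adjacency_div v x :
  degree x * (adjacency v x / degree x) = adjacency v x.
Proof.
have [d0|dx] := eqVneq (degree x) 0; last by rewrite mulrC divfK.
by rewrite d0 mul0r [RHS]big1 // => y _; rewrite weight_degree0 ?mul0r.
Qed.

Hypothesis N_gt0 :
  forall x y, x != y -> degree x != 0 -> degree y != 0 -> 0 < N x y.

Lemma harmonic_constant v x y : (forall z, laplacian v z = 0) ->
  degree x != 0 -> degree y != 0 -> v x = v y.
Proof.
move=> v_harm dx dy; have [->//|xy] := eqVneq x y.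
have energy_term_ge0 a b : 0 <= N a b * (v a - v b) ^+ 2.
  by rewrite mulr_ge0 ?sqr_ge0.
have /eqP : \sum_a \sum_b N a b * (v a - v b) ^+ 2 = 0.
  by rewrite -laplacian_energy big1 ?mul0rn // => z _; rewrite v_harm mulr0.
rewrite psumr_eq0 => [/allP/(_ x (mem_index_enum x))|a _]; last exact: sumr_ge0.
rewrite psumr_eq0 // => /allP/(_ y (mem_index_enum y)).
by rewrite /= mulf_eq0 sqrf_eq0 gt_eqF ?N_gt0 //= subr_eq0 => /eqP.
Qed.

Lemma poisson_solvable v : \sum_x v x * degree x = 0 ->
  exists w, forall x, laplacian w x = degree x * v x.
Proof.
move=> v_mean0; pose L x y := (x == y)%:R * degree x - N x y.
have L_laplacian c x : \sum_y L x y * c y = laplacian c x.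
  under eq_bigr do rewrite mulrBl; rewrite sumrB (bigD1 x) //= eqxx mul1r.
  by rewrite big1 ?addr0 // => y yx; rewrite eq_sym (negbTE yx) !mul0r.
have L_sym x y : L x y = L y x.
  by rewrite /L N_sym eq_sym; case: eqP => [->|_] //; rewrite !mul0r.
have [|w wE] := @fredholm_alternative _ _ _ L (fun x => degree x * v x).
  move=> c c_ker; have c_harm x : laplacian c x = 0.
    rewrite -L_laplacian -[RHS](c_ker x).
    by apply: eq_bigr => y _; rewrite L_sym mulrC.
  have [x dx|d0] := pickP (fun x => degree x != 0); last first.
    by rewrite big1 // => x _; move/negbFE/eqP: (d0 x) => ->; ring.
  rewrite -[RHS](mulr0 (c x)) -[X in c x * X]v_mean0 mulr_sumr.
  apply: eq_bigr => y _; have [->|dy] := eqVneq (degree y) 0; first by ring.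
  by rewrite (harmonic_constant c_harm dy dx); ring.
by exists w => x; rewrite -L_laplacian.
Qed.

Hypothesis contraction :
  forall v, bform v v <= \sum_x adjacency v x ^+ 2 / degree x.

(* With K = D^-1 N, where D is the diagonal of degrees, one has
   <v, v>_N = <v, K v>_D and the contraction hypothesis reads K <= K ^ 2.
   Solving v = w - K w gives
   <v, K v> = (<w, K w> - <K w, K w>) + (<K w, K (K w)> - <K w, K w>) <= 0. *)
Lemma bform_le0_orthogonal1 v : bform v (fun=> 1) = 0 -> bform v v <= 0.
Proof.
rewrite bform1r => /poisson_solvable[w wE].
pose Kw x := adjacency w x / degree x.
have vE u : bform v u = bform (fun x => 1 * w x + (-1) * Kw x) u.
  apply: eq_bigr => x _; rewrite -[adjacency u x]degree_mul_adjacency_div.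
  rewrite mulrCA mulrA -wE /laplacian -[adjacency w x]degree_mul_adjacency_div.
  by rewrite -/(Kw x); ring.
have Kw_w : bform Kw w = \sum_x adjacency w x ^+ 2 / degree x.
  by apply: eq_bigr => x _; rewrite /Kw; ring.
have Kw_D : \sum_x degree x * Kw x ^+ 2 = bform Kw w.
  by apply: eq_bigr => x _; rewrite expr2 mulrA degree_mul_adjacency_div mulrC.
have := contraction w; have := bform_le_degree Kw; rewrite Kw_D -Kw_w.
rewrite vE (bform_sym _ v) vE !(bform_linearl, bform_linearr) (bform_sym w Kw).
by lra.
Qed.

Lemma hyperbolic_of_contraction : hyperbolic.
Proof.
move=> v; set one := fun=> 1; set m := bform one one.
have : 0 <= m.
  by rewrite /m bform1r sumr_ge0 // => x _; rewrite mul1r degree_ge0.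
rewrite le_eqVlt => /predU1P[<-|m_gt0]; first by rewrite mulr0 sqr_ge0.
pose v' x := m * v x + (- bform v one) * one x.
have v'1 : bform v' one = 0 by rewrite bform_linearl -/m; ring.
have := bform_le0_orthogonal1 v'1.
rewrite bform_linearl !bform_linearr (bform_sym one v) -/m => v'v'_le0.
by rewrite -subr_le0 -(pmulr_rle0 _ m_gt0); lra.
Qed.

End SymmetricForms.

Section MinimalElements.

Variables (d : Order.disp_t) (X : finPOrderType d).
Implicit Types (S : {set X}) (x y z : X).

Definition minimal S x := (x \in S) && [forall y in S, ~~ (y < x)%O].

(* The number of ways of removing successively n minimal elements from S, that
   is, of linear extensions of the poset induced on S when #|S| = n. *)
Fixpoint ext n S : nat :=
  if n is n'.+1 then \sum_(x | minimal S x) ext n' (S :\ x) else 1.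

Lemma minimal_in S x : minimal S x -> x \in S.
Proof. by case/andP. Qed.

Lemma card_minimalD1 S x : minimal S x -> #|S| = #|S :\ x|.+1.
Proof. by move=> xS; rewrite (cardsD1 x) (minimal_in xS). Qed.

Lemma minimalD1 S x y : y \in S -> x != y ->
  minimal S x = minimal (S :\ y) x && ~~ (y < x)%O.
Proof.
move=> yS xy; rewrite /minimal !inE xy /=; case: (x \in S) => //=.
apply/forall_inP/andP => [xmin|[/forall_inP xmin yx] z zS].
  by split; [apply/forall_inP => z /setD1P[_ /xmin] | apply: xmin].
by have [->//|zy] := eqVneq z y; rewrite xmin // !inE zy.
Qed.

Lemma minimal_set1 x y : minimal [set x] y = (y == x).
Proof.
rewrite /minimal inE andb_idr // => /eqP ->.
by apply/forall_inP => z /set1P ->; rewrite ltxx.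
Qed.

Lemma minimal_exists S : S != set0 -> exists x, minimal S x.
Proof.
case/set0Pn => x0 x0S.
case: (arg_minnP (fun x => #|[set y | (y < x)%O]|) x0S) => x xS xmin.
exists x; apply/andP; split=> //; apply/forall_inP => y yS.
apply: contraTN (xmin y yS) => yx; rewrite -ltnNge.
apply/proper_card/properP; split.
  by apply/subsetP => z; rewrite !inE => /lt_trans->.
by exists y; rewrite inE ?ltxx.
Qed.

Lemma ext_gt0 n S : (n <= #|S|)%N -> (0 < ext n S)%N.
Proof.
elim: n S => [|n IH] S //= nS.
have /minimal_exists[x xmin] : S != set0 by rewrite -card_gt0 (leq_trans _ nS).
by rewrite (bigD1 x) //= ltn_addr // IH // -ltnS -card_minimalD1.
Qed.

(* Equivalently, x, y, z are distinct and {x, y, z} is a lower set of S. *)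
Definition initial3 S x y z :=
  [&& minimal (S :\ y :\ z) x, minimal (S :\ x :\ z) y
    & minimal (S :\ x :\ y) z].

Lemma initial3E S x y z :
  [&& minimal S x, minimal (S :\ x) y & minimal (S :\ x :\ y) z]
    = initial3 S x y z && [&& ~~ (y < x)%O, ~~ (z < x)%O & ~~ (z < y)%O].
Proof.
rewrite /initial3.
have [zS|_] := boolP (minimal (S :\ x :\ y) z); last by rewrite !andbF.
have /setD1P[zy /setD1P[zx z_in]] := minimal_in zS.
rewrite !andbT.
have [y_in|/negbTE y_notin] := boolP (y \in S :\ x); last first.
  by rewrite /minimal [y \in S :\ x :\ z]in_setD1 y_notin !(andbF, andFb).
have /setD1P[yx yS] := y_in.
have [xy xz yz] : [/\ x != y, x != z & y != z] by split; rewrite eq_sym.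
rewrite (minimalD1 yS xy) (@minimalD1 (S :\ y) x z) ?inE ?zy //.
rewrite (@minimalD1 (S :\ x) y z) ?inE ?zx //.
by rewrite -!andbA; do ?bool_congr.
Qed.

End MinimalElements.

Section FirstLetters.

Variables (d : Order.disp_t) (X : finPOrderType d).
Implicit Types (S : {set X}) (x y z : X).

(* In a linear extension starting with x, y, the letter y is credited to x
   unless it could have come first; this makes first_two symmetric. *)
Definition credit x y := if (x < y)%O then x else y.

Definition first_two n S x y : nat :=
  \sum_(z | [&& minimal S x, minimal (S :\ x) z & credit x z == y])
     ext n (S :\ x :\ z).

Lemma first_two_neq n S x y : x != y ->
  first_two n S x y =
    if minimal S x && minimal S y then ext n (S :\ x :\ y) else 0.
Proof.
move=> xy; have credit_eq z : (credit x z == y) = (z == y) && ~~ (x < y)%O.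
  rewrite /credit; have [->|/negbTE zy] := eqVneq z y.
    by case: ifP; rewrite ?(negbTE xy) ?eqxx.
  by case: ifP; rewrite ?(negbTE xy) ?zy.
rewrite /first_two.
have [xS|_] := boolP (minimal S x); last by rewrite big_pred0.
rewrite (minimalD1 (minimal_in xS)) 1?eq_sym //; case: ifPn => xyS.
  apply: big_pred1 => z; rewrite credit_eq /=.
  by have [->|_] := eqVneq z y; rewrite ?andbF.
apply: big_pred0 => z; rewrite credit_eq /=.
by have [->|_] := eqVneq z y; rewrite /= ?andbF; first exact: negbTE.
Qed.

Lemma first_twoC n S x y : first_two n S x y = first_two n S y x.
Proof.
have [->//|xy] := eqVneq x y.
by rewrite !first_two_neq // 1?eq_sym // andbC setD1C.
Qed.

Variable R : realFieldType.
Implicit Types v w : X -> R.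

Definition first_two_weight n S x y : R := (first_two n S x y)%:R.

Lemma adjacency_first_two n S v x : adjacency (first_two_weight n S) v x =
  \sum_(y | minimal S x && minimal (S :\ x) y)
     v (credit x y) * (ext n (S :\ x :\ y))%:R.
Proof.
rewrite (partition_big (credit x) xpredT) //=; apply: eq_bigr => y _.
rewrite /first_two_weight natr_sum mulr_suml; apply: eq_big => [z|z].
  by rewrite andbA.
by case/and3P => _ _ /eqP ->; rewrite mulrC.
Qed.

Lemma bform_first_two n S v w : bform (first_two_weight n S) v w =
  \sum_(x | minimal S x) \sum_(y | minimal (S :\ x) y)
     v x * w (credit x y) * (ext n (S :\ x :\ y))%:R.
Proof.
rewrite [RHS]big_mkcond; apply: eq_bigr => x _; rewrite adjacency_first_two.
case: minimal; last by rewrite big_pred0_eq mulr0.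
by rewrite mulr_sumr; apply: eq_bigr => y _; rewrite mulrA.
Qed.

Lemma degree_first_two n S x : degree (first_two_weight n S) x =
  if minimal S x then (ext n.+1 (S :\ x))%:R else 0.
Proof.
rewrite -adjacency1 adjacency_first_two.
case: minimal; last by rewrite big_pred0_eq.
by rewrite natr_sum; apply: eq_bigr => y _; rewrite mul1r.
Qed.

Lemma bform1r_first_two n S v : bform (first_two_weight n S) v (fun=> 1) =
  \sum_(x | minimal S x) v x * (ext n.+1 (S :\ x))%:R.
Proof.
rewrite bform1r [RHS]big_mkcond; apply: eq_bigr => x _.
by rewrite degree_first_two; case: ifP; rewrite ?mulr0.
Qed.

Definition initial3_weight n S x y z : R :=
  (initial3 S x y z)%:R * (ext n (S :\ x :\ y :\ z))%:R.

Lemma initial3_weight_swap12 n S x y z :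
  initial3_weight n S y x z = initial3_weight n S x y z.
Proof.
by rewrite /initial3_weight /initial3 [S :\ y :\ x]setD1C andbCA.
Qed.

Lemma initial3_weight_swap23 n S x y z :
  initial3_weight n S x z y = initial3_weight n S x y z.
Proof.
rewrite /initial3_weight /initial3 [S :\ z :\ y]setD1C [S :\ x :\ z :\ y]setD1C.
by rewrite [minimal (S :\ x :\ y) z && _]andbC.
Qed.

(* The contribution of the order x, y, z to the difference of the two sides of
   bform_first_two_le, when {x, y, z} is a lower set. *)
Definition credit_gap v x y z : R :=
  if [&& ~~ (y < x)%O, ~~ (z < x)%O & ~~ (z < y)%O]
  then v (credit x y) * (v (credit x (credit y z)) - v x) else 0.

Definition upper_bound_gap v x y z : R :=
  [&& (x < y)%O, (z < y)%O, ~~ (x < z)%O & ~~ (z < x)%O]%:R * (v x - v z) ^+ 2.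

(* The orders cancel in pairs or contribute 0, except those of two incomparable
   elements followed by an element above both. *)
Lemma credit_gap_sum v x y z :
  credit_gap v x y z + credit_gap v x z y + credit_gap v y x z
    + credit_gap v y z x + credit_gap v z x y + credit_gap v z y x
  = upper_bound_gap v x y z + upper_bound_gap v y x z + upper_bound_gap v x z y.
Proof.
rewrite /credit_gap /upper_bound_gap /credit !(fun_if (Order.lt _)).
move: (lt_asym x y) (lt_asym x z) (lt_asym y z).
case: (x < y)%O; case: (y < x)%O; case: (x < z)%O; case: (z < x)%O;
  case: (y < z)%O; case: (z < y)%O => //= _ _ _.
all: ring.
Qed.

Lemma credit_gap_weighted_sum n S v :
  \sum_(x | minimal S x)
      bform (first_two_weight n (S :\ x)) (v \o credit x) (v \o credit x)
    - bform (first_two_weight n.+1 S) v v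
  = \sum_x \sum_y \sum_z initial3_weight n S x y z * credit_gap v x y z.
Proof.
rewrite bform_first_two -sumrB big_mkcond; apply: eq_bigr => x _.
have weighted_gapE y z : initial3_weight n S x y z * credit_gap v x y z =
    if [&& minimal S x, minimal (S :\ x) y & minimal (S :\ x :\ y) z]
    then (ext n (S :\ x :\ y :\ z))%:R *
         (v (credit x y) * (v (credit x (credit y z)) - v x)) else 0.
  rewrite initial3E /initial3_weight /credit_gap.
  by case: initial3 => /=; case: ifP; rewrite ?(mul0r, mulr0) // mul1r.
under [RHS]eq_bigr do under eq_bigr do rewrite weighted_gapE.
case: (minimal S x); last first.
  by rewrite [RHS]big1 // => y _; rewrite big1.
rewrite bform_first_two -sumrB big_mkcond; apply: eq_bigr => y _ /=.
case: (minimal (S :\ x) y); last by rewrite big1.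
by rewrite natr_sum mulr_sumr -sumrB -big_mkcond; apply: eq_bigr => z _; ring.
Qed.

Lemma bform_first_two_le n S v : bform (first_two_weight n.+1 S) v v <=
  \sum_(x | minimal S x)
     bform (first_two_weight n (S :\ x)) (v \o credit x) (v \o credit x).
Proof.
rewrite -subr_ge0 credit_gap_weighted_sum -(pmulrn_lge0 _ (ltn0Sn 5)).
rewrite sum3_symmetrize.
apply: sumr_ge0 => x _; apply: sumr_ge0 => y _; apply: sumr_ge0 => z _.
rewrite (initial3_weight_swap12 n S y z x) (initial3_weight_swap23 n S y x z).
rewrite (initial3_weight_swap12 n S x z y) (initial3_weight_swap23 n S x y z).
rewrite (initial3_weight_swap12 n S x y z) -!mulrDr credit_gap_sum.
apply: mulr_ge0; first by rewrite mulr_ge0 ?ler0n.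
by rewrite !addr_ge0 // mulr_ge0 ?ler0n ?sqr_ge0.
Qed.

Lemma bform_first_two_pair S a b v w : minimal S a -> S :\ a = [set b] ->
  bform (first_two_weight 0 S) v w =
    if (a < b)%O then v a * w a else v a * w b + v b * w a.
Proof.
move=> amin Sa; have /setD1P[ba bS] : b \in S :\ a by rewrite Sa set11.
have minE x : minimal S x = (x == a) || (x == b) && ~~ (a < b)%O.
  have [->|xa] := eqVneq x a; first by rewrite amin.
  rewrite (minimalD1 (minimal_in amin)) // Sa minimal_set1.
  by case: eqP => [->|].
have sum_min1 c (F : X -> R) : \sum_(y | minimal [set c] y) F y = F c.
  by apply: big_pred1 => y; apply: minimal_set1.
rewrite bform_first_two; case: ifPn => ab.
  rewrite (big_pred1 a) => [|x]; last by rewrite minE ab andbF orbF.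
  by rewrite Sa sum_min1 /credit ab mulr1.
have not_ba : (b < a)%O = false.
  by apply/negbTE; case/andP: amin => _ /forall_inP/(_ b bS).
have Sb : S :\ b = [set a].
  by rewrite -(setD1K (minimal_in amin)) Sa setUC setU1K // inE.
rewrite (bigD1 a amin) Sa sum_min1 (big_pred1 b) => [|x]; last first.
  rewrite minE ab; have [->|_] := eqVneq x a; rewrite /= ?andbF ?andbT //.
  by rewrite eq_sym (negbTE ba).
by rewrite /= Sb sum_min1 /credit (negbTE ab) not_ba !mulr1.
Qed.

Lemma first_two_hyperbolic_card2 S :
  #|S| = 2%N -> hyperbolic (first_two_weight 0 S).
Proof.
move=> S2 v.
have /minimal_exists[a amin] : S != set0 by rewrite -card_gt0 S2.
have /cards1P[b Sa] : #|S :\ a| == 1%N.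
  by move: S2; rewrite (card_minimalD1 amin) => -[->].
rewrite !(bform_first_two_pair _ _ amin Sa); have := sqr_ge0 (v a - v b).
by case: ifP => _; nra.
Qed.

Lemma first_two_hyperbolic n S :
  #|S| = n.+2 -> hyperbolic (first_two_weight n S).
Proof.
elim: n S => [|n IH] S Sn; first exact: first_two_hyperbolic_card2.
have cardD1 x : minimal S x -> #|S :\ x| = n.+2.
  by move=> xS; move: Sn; rewrite (card_minimalD1 xS) => -[].
apply: hyperbolic_of_contraction => [x y|x y|x y xy|v].
- by rewrite /first_two_weight first_twoC.
- exact: ler0n.
- rewrite !degree_first_two /first_two_weight first_two_neq //.
  case: ifP => [xS _|_ /eqP//]; case: ifP => [yS _|_ /eqP//].
  rewrite ltr0n ext_gt0 //; move: (cardD1 x xS).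
  by rewrite (cardsD1 y) !inE eq_sym xy (minimal_in yS) add1n => -[->].
apply: (le_trans (bform_first_two_le n S v)); rewrite big_mkcond.
apply: ler_sum => x _; rewrite adjacency_first_two degree_first_two.
case: ifP => [xS|_]; last by rewrite invr0 mulr0.
rewrite ler_pdivlMr; last by rewrite ltr0n ext_gt0 // cardD1.
have := IH (S :\ x) (cardD1 x xS) (v \o credit x); rewrite !bform1r_first_two.
by rewrite /= natr_sum; under [X in _ * X]eq_bigr do rewrite mul1r.
Qed.

End FirstLetters.

Section Counting.

Variables (d : Order.disp_t) (X : finPOrderType d).
Implicit Types (p : seq X) (x y : X) (f : {ffun X -> 'I_#|X|}) (A : {set X}).

Definition starts_with p f := [seq val (f x) | x <- p] == iota 0 (size p).

Definition linear_prefix p :=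
  uniq p /\ forall x y, y \in p -> (x < y)%O -> (index x p < index y p)%N.

Definition rest p : {set X} := ~: [set x in p].

Definition count_prefix p (E : pred {ffun X -> 'I_#|X|}) : nat :=
  #|[set f in lin_ext X | starts_with p f && E f]|.

Lemma lin_extP f :
  reflect (injective f /\ {homo f : x y / (x < y)%O >-> (x < y)%N})
          (f \in lin_ext X).
Proof.
rewrite inE; apply: (iffP andP) => [[/andP[/injectiveP f_inj _] f_incr]|].
  split=> // x y; exact: (implyP (forallP (forallP f_incr x) y)).
move=> [f_inj f_incr]; split; last first.
  by apply/forallP => x; apply/forallP => y; apply/implyP/f_incr.
have [g _ gK] : bijective f by apply: inj_card_bij; rewrite ?card_ord.
apply/andP; split; first exact/injectiveP.
by apply/forallP => i; apply/existsP; exists (g i); rewrite gK.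
Qed.

Lemma starts_with_rcons p x f :
  starts_with (rcons p x) f = starts_with p f && (f x == size p :> nat).
Proof.
by rewrite /starts_with map_rcons size_rcons -addn1 iotaD cats1 eqseq_rcons.
Qed.

Lemma starts_with_mem p f x : injective f -> starts_with p f ->
  (x \in p) = (f x < size p)%N.
Proof.
move=> f_inj /eqP fp.
by rewrite -(mem_map (inj_comp val_inj f_inj)) fp mem_iota.
Qed.

Lemma rest_nil : rest [::] = setT.
Proof. by rewrite /rest set_nil setC0. Qed.

Lemma rest_rcons p x : rest (rcons p x) = rest p :\ x.
Proof. by apply/setP => y; rewrite !inE mem_rcons inE negb_or. Qed.

Lemma linear_prefix_rcons p x :
  linear_prefix p -> minimal (rest p) x -> linear_prefix (rcons p x).
Proof.
move=> [p_uniq p_incr] /andP[]; rewrite !inE => xp /forall_inP xmin; split.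
  by rewrite rcons_uniq xp.
have below_x y : (y < x)%O -> y \in p.
  by apply: contraTT => yp; apply: xmin; rewrite !inE.
move=> y z; rewrite mem_rcons inE -cats1 !index_cat => /predU1P[->|zp] yz.
  by rewrite (negbTE xp) below_x //= eqxx addn0 index_mem below_x.
have yz_index := p_incr y z zp yz.
by rewrite zp ifT // -index_mem (ltn_trans yz_index) // index_mem.
Qed.

Lemma rest_seq1 x : rest [:: x] = setT :\ x.
Proof. by rewrite (rest_rcons [::]) rest_nil. Qed.

Lemma linear_prefix_seq1 x : minimal setT x -> linear_prefix [:: x].
Proof.
by move=> xmin; apply: (@linear_prefix_rcons [::]); rewrite ?rest_nil.
Qed.

Lemma minimal_next p f x : f \in lin_ext X -> starts_with p f ->
  f x = size p :> nat -> minimal (rest p) x.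
Proof.
move=> /lin_extP[f_inj f_incr] fp fx.
rewrite /minimal !inE (starts_with_mem _ f_inj fp) fx ltnn.
apply/forall_inP => y; rewrite !inE; apply: contraNN => /f_incr.
by rewrite fx (starts_with_mem _ f_inj fp).
Qed.

Lemma count_prefix_rcons p (E : pred {ffun X -> 'I_#|X|}) :
  (size p < #|X|)%N ->
  count_prefix p E
    = (\sum_(x | minimal (rest p) x) count_prefix (rcons p x) E)%N.
Proof.
move=> pX; rewrite /count_prefix; set D := [set f in _ | _].
have unique_next f : f \in D -> #|[pred x | f x == size p :> nat]| = 1%N.
  rewrite inE => /and3P[/lin_extP[f_inj _] _ _].
  have [g fK gK] : bijective f by apply: inj_card_bij; rewrite ?card_ord.
  by apply: (@eq_card1 _ (g (Ordinal pX))) => x; rewrite !inE -(can_eq fK) gK.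
rewrite -sum1_card.
under eq_bigr => f fD do rewrite -(unique_next f fD) -sum1_card.
rewrite (exchange_big_dep xpredT) //= [RHS]big_mkcond; apply: eq_bigr => x _.
rewrite sum1_card; case: ifPn => xmin.
  apply: eq_card => f; rewrite unfold_in /= !inE starts_with_rcons.
  by rewrite -!andbA [E f && _]andbC.
apply: eq_card0 => f; apply: contraNF xmin; rewrite unfold_in /= => /andP[].
by rewrite in_set => /and3P[f_lin fp _] /eqP; apply: minimal_next.
Qed.

Lemma count_prefix_full p : linear_prefix p -> size p = #|X| ->
  count_prefix p predT = 1%N.
Proof.
move=> [p_uniq p_incr] pX.
have p_all x : x \in p.
  have [_ ->] : (size p = size (enum X)) * (p =i enum X); last exact: mem_enum.
  by apply: uniq_min_size; rewrite -?cardE ?pX // => y _; rewrite mem_enum.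
have index_lt x : (index x p < #|X|)%N by rewrite -pX index_mem.
pose f0 : {ffun X -> 'I_#|X|} := [ffun x => Ordinal (index_lt x)].
have f0E x : f0 x = index x p :> nat by rewrite ffunE.
have f0_starts : [seq val (f0 x) | x <- p] = iota 0 (size p).
  by rewrite -map_index_uniq //; apply: eq_map.
rewrite /count_prefix (_ : [set f in _ | _] = [set f0]) ?cards1 //.
apply/setP => f; rewrite inE in_set1 andbT; apply/andP/eqP => [[_ /eqP]|->].
  rewrite -f0_starts => /eq_in_map f_f0.
  by apply/ffunP => x; apply/val_inj/f_f0.
split; last exact/eqP.
apply/lin_extP; split=> [x y /(congr1 val)|x y xy]; rewrite /= !f0E.
  exact: index_inj.
exact: p_incr.
Qed.

Lemma count_prefix_ext p : linear_prefix p ->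
  count_prefix p predT = ext (#|X| - size p) (rest p).
Proof.
have [k] := ubnP (#|X| - size p).
elim: k p => // k IH p; rewrite ltnS => pk p_lin.
have := uniq_leq_size p_lin.1 (fun x _ => mem_enum X x); rewrite -cardE.
rewrite leq_eqVlt => /predU1P[pX|pX].
  by rewrite count_prefix_full // pX subnn.
rewrite count_prefix_rcons // -(subnSK pX) /=; apply: eq_bigr => x xmin.
rewrite IH ?size_rcons ?rest_rcons //; last exact: linear_prefix_rcons.
by rewrite -subnSK in pk.
Qed.

Lemma fmin_gt A f k :
  A != set0 -> (k < fmin A f)%N = [forall a in A, (k <= f a)%N].
Proof.
case/set0Pn => a aA; apply/(@bigmin_geP _ nat)/forall_inP => [[_]//|fA].
by split; [apply: leq_ltn_trans (fA a aA) (ltn_ord _) | exact: fA].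
Qed.

Lemma fmin_gt_prefix A p f : A != set0 -> injective f -> starts_with p f ->
  (size p < fmin A f)%N = ~~ has [in A] p.
Proof.
move=> A0 f_inj fp; rewrite fmin_gt //; apply/forall_inP/hasPn => fA x.
  by apply: contraL => /fA; rewrite leqNgt (starts_with_mem _ f_inj fp).
by rewrite leqNgt -(starts_with_mem _ f_inj fp); apply: contraL => /fA.
Qed.

Lemma count_prefix_fmin A p : A != set0 -> linear_prefix p ->
  count_prefix p (fun f => size p < fmin A f)%N
    = if has [in A] p then 0%N else ext (#|X| - size p) (rest p).
Proof.
move=> A0 p_lin; rewrite -count_prefix_ext //; case: ifP => Ap.
  apply: eq_card0 => f; rewrite inE.
  apply/negP => /and3P[/lin_extP[f_inj _] fp].
  by rewrite fmin_gt_prefix // Ap.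
apply: eq_card => f; rewrite inE [RHS]inE.
apply: andb_id2l => /lin_extP[f_inj _].
by apply: andb_id2l => fp; rewrite fmin_gt_prefix // Ap.
Qed.

Definition avoiding A k := [set f in lin_ext X | (k < fmin A f)%N].

Lemma card_lin_ext : #|lin_ext X| = ext #|X| (setT : {set X}).
Proof.
have -> : #|lin_ext X| = count_prefix [::] predT.
  by apply: eq_card => f; rewrite [RHS]inE andbT.
by rewrite count_prefix_ext // subn0 rest_nil.
Qed.

Lemma card_avoiding1 A : A != set0 ->
  #|avoiding A 1| =
    (\sum_(x | minimal setT x && (x \notin A)) ext #|X|.-1 (setT :\ x))%N.
Proof.
move=> A0; have X_gt0 : (0 < #|X|)%N.
  by have /set0Pn[a _] := A0; apply/card_gt0P; exists a.
rewrite -[LHS]/(count_prefix [::] _) count_prefix_rcons // rest_nil.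
rewrite [RHS]big_mkcondr; apply: eq_bigr => x xmin.
rewrite (count_prefix_fmin A0 (linear_prefix_seq1 xmin)) rest_seq1 subn1.
by rewrite /= orbF if_neg.
Qed.

Lemma card_avoiding2 A : A != set0 -> (1 < #|X|)%N ->
  #|avoiding A 2| =
    (\sum_(x | minimal setT x && (x \notin A))
     \sum_(y | minimal (setT :\ x) y && (y \notin A))
       ext #|X|.-2 (setT :\ x :\ y))%N.
Proof.
move=> A0 X_gt1.
rewrite -[LHS]/(count_prefix [::] _) count_prefix_rcons ?rest_nil 1?ltnW //.
rewrite [RHS]big_mkcondr; apply: eq_bigr => x xmin.
rewrite count_prefix_rcons // rest_seq1.
transitivity (\sum_(y | minimal (setT :\ x) y)
    if (x \in A) || (y \in A) then 0 else ext #|X|.-2 (setT :\ x :\ y))%N.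
  apply: eq_bigr => y ymin; have xy_lin : linear_prefix [:: x; y].
    apply: (@linear_prefix_rcons [:: x]); first exact: linear_prefix_seq1.
    by rewrite rest_seq1.
  rewrite (count_prefix_fmin A0 xy_lin) (rest_rcons [:: x]) rest_seq1 subn2.
  by rewrite /= orbF.
case: (x \in A) => /=; first by rewrite big1.
by rewrite [RHS]big_mkcondr; apply: eq_bigr => y _; rewrite if_neg.
Qed.

Lemma avoiding_log_concave A : A != set0 -> (1 < #|X|)%N ->
  (#|lin_ext X| * #|avoiding A 2| <= #|avoiding A 1| ^ 2)%N.
Proof.
move=> A0 X_gt1.
have [n Xn] : exists n, #|X| = n.+2.
  by exists #|X|.-2; rewrite -subn2 -addn2 subnK.
pose v x : rat := (x \notin A)%:R; pose M := first_two_weight rat n [set: X].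
have lin_extE : #|lin_ext X|%:R = bform M (fun=> 1) (fun=> 1).
  rewrite card_lin_ext Xn natr_sum bform1r_first_two.
  by apply: eq_bigr => x _; rewrite mul1r.
have avoiding1E : #|avoiding A 1|%:R = bform M v (fun=> 1).
  rewrite card_avoiding1 // Xn natr_sum bform1r_first_two big_mkcondr.
  by apply: eq_bigr => x _; rewrite /v; case: (x \in A); rewrite ?mul0r ?mul1r.
have avoiding2_le : #|avoiding A 2|%:R <= bform M v v.
  rewrite card_avoiding2 // Xn natr_sum bform_first_two big_mkcondr.
  apply: ler_sum => x _; rewrite {1}/v; case: (boolP (x \in A)) => xA /=.
    by rewrite big1 // => y _; rewrite !mul0r.
  rewrite natr_sum big_mkcondr; apply: ler_sum => y _.
  rewrite mul1r /v /credit; case: (x < y)%O; case: (y \in A) => /=;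
    by rewrite ?xA ?mul1r ?mul0r ?ler0n.
have lin_ext_ge0 : 0 <= bform M (fun=> 1) (fun=> 1) by rewrite -lin_extE ler0n.
rewrite -(ler_nat rat) natrM natrX lin_extE avoiding1E mulrC.
apply: le_trans (ler_wpM2r lin_ext_ge0 avoiding2_le) _.
by apply: first_two_hyperbolic; rewrite cardsT.
Qed.

Lemma lin_ext_gt0 : (0 < #|lin_ext X|)%N.
Proof. by rewrite card_lin_ext ext_gt0 // cardsT. Qed.

Lemma Pr_total (E : pred {ffun X -> 'I_#|X|}) : (forall f, E f) -> Pr E = 1.
Proof.
move=> E_total; rewrite /Pr (_ : [set f in _ | _] = lin_ext X).
  by rewrite divff // pnatr_eq0 -lt0n lin_ext_gt0.
by apply/setP => f; rewrite in_set E_total andbT.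
Qed.

Lemma Pr_fmin_gt_split A k : Pr (fun f => (k < fmin A f)%N)
  = Pr (fun f => fmin A f == k.+1) + Pr (fun f => (k.+1 < fmin A f)%N).
Proof.
rewrite /Pr -mulrDl -natrD -(cardsID [set f | fmin A f == k.+1]).
congr ((_ + _)%:R / _); apply: eq_card => f; rewrite !inE.
  by rewrite -andbA [(k < _)%N && _]andb_idl // => /eqP ->.
by rewrite andbCA [in RHS]ltn_neqAle eq_sym.
Qed.

Lemma Pr_fmin_gt2_le A : A != set0 -> (1 < #|X|)%N ->
  Pr (fun f => (2 < fmin A f)%N) <= Pr (fun f => (1 < fmin A f)%N) ^+ 2.
Proof.
move=> A0 X_gt1.
have lin_gt0 : 0 < #|lin_ext X|%:R :> rat by rewrite ltr0n lin_ext_gt0.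
rewrite /Pr expr_div_n ler_pdivlMr ?exprn_gt0 // expr2 mulrA divfK ?gt_eqF //.
by rewrite mulrC -natrM -natrX ler_nat avoiding_log_concave.
Qed.

End Counting.

Theorem theorem1p6 (d : Order.disp_t) (X : finPOrderType d)
    (hX : (2 <= #|X|)%N) (A : {set X}) (hA : A != set0) :
  (Pr (fun f => (2 < fmin A f)%N) <= Pr (fun f => (1 < fmin A f)%N) ^+ 2)%R
  /\ (Pr (fun f => fmin A f == 1%N) * Pr (fun f => (1 < fmin A f)%N)
      <= Pr (fun f => fmin A f == 2%N))%R.
Proof.
have gt2_le := Pr_fmin_gt2_le hA hX; split=> //.
have gt0 : Pr (fun f => 0 < fmin A f)%N = 1.
  by apply: Pr_total => f; rewrite fmin_gt //; apply/forall_inP.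
have := Pr_fmin_gt_split A 0; rewrite gt0 => /eqP; rewrite -subr_eq => /eqP <-.
have := Pr_fmin_gt_split A 1 => /eqP; rewrite -subr_eq => /eqP <-.
by rewrite mulrBl mul1r -expr2 lerB.
Qed.
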